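(* Let $l\ge1$ and let $n,s_1,s_2,\dots,s_l$ be positive integers. Put $w=\sum_{i=1}^l s_i$ and $I=\{s_1,\,s_1+s_2,\,\dots,\,s_1+s_2+\dots+s_{l-1}\}$ (so $I=\emptyset$ if $l=1$). Then $$\sum_{k=1}^n \genfrac{[}{]}{0pt}{}{n}{k}_q(-1)^{k}q^{\binom{k}{2}+k}\sum_{1\leq k_1<k_2<\cdots<k_l=k}\ \prod_{i=1}^l\frac{q^{(s_i-1)k_i}}{[k_i]_q^{s_i}}=(-1)^l\sum_{\substack{1\leq j_1\leq j_2\leq\dots\leq j_w\leq n\\ j_i<j_{i+1},\; i\in I}}\ \prod_{i=1}^w\frac{q^{j_i}}{[j_i]_q}$$ and $$\sum_{k=1}^n \genfrac{[}{]}{0pt}{}{n}{k}_q(-1)^{k}q^{\binom{k}{2}-nk}\sum_{\substack{1\leq j_1\leq j_2\leq\dots\leq j_w=k\\ j_i<j_{i+1},\; i\in I}}\ \prod_{i=1}^w\frac{q^{j_i}}{[j_i]_q}=(-1)^l\sum_{1\leq k_1<k_2<\cdots<k_l\leq n}\ \prod_{i=1}^l\frac{q^{(s_i-1)k_i}}{[k_i]_q^{s_i}}.$$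
   Context: Here $q$ is an indeterminate (the identities hold in $\mathbb{Q}(q)$), $[n]_q=\frac{1-q^n}{1-q}=1+q+\cdots+q^{n-1}$, and $\genfrac{[}{]}{0pt}{}{n}{k}_q=\prod_{j=1}^k\frac{1-q^{n-k+j}}{1-q^j}$ is the Gaussian $q$-binomial coefficient. In the sums over $j_1,\dots,j_w$ the inequality $j_i\le j_{i+1}$ is required for all $1\le i\le w-1$, and it is required to be strict for $i\in I$. *)

(* Defs.v *)
From HB Require Import structures.
From mathcomp Require Import all_boot all_order all_algebra.

Set Implicit Arguments.
Unset Strict Implicit.
Unset Printing Implicit Defensive.

Import GRing.Theory.
Local Open Scope ring_scope.

Definition Qq : fieldType := {fraction {poly rat}}.
Definition qvar : Qq := tofrac ('X : {poly rat}).

Definition qint (F : fieldType) (q : F) (n : nat) : F :=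
  (1 - q ^+ n) / (1 - q).

(* The exponent n - k + j uses truncated subtraction, so this is the Gaussian
   binomial only for k <= n. *)
Definition qbinom (F : fieldType) (q : F) (n k : nat) : F :=
  \prod_(1 <= j < k.+1) ((1 - q ^+ (n - k + j)) / (1 - q ^+ j)).

Section Index.
Local Open Scope nat_scope.

(* Families are indexed by ordinals, so position i.+1 of the 1-based families
   (k_1, ..., k_l), (j_1, ..., j_w), (s_1, ..., s_l) is entry i here. *)

Definition weight (l : nat) (s : 'I_l -> nat) : nat := \sum_(i < l) s i.

(* {s_1, s_1 + s_2, ..., s_1 + ... + s_(l-1)}, as 1-based positions. *)
Definition jumps (l : nat) (s : 'I_l -> nat) : seq nat :=
  [seq \sum_(i < l | i < m) s i | m <- iota 1 l.-1].

Definition strict_chain (l n : nat) (k : {ffun 'I_l -> 'I_n.+1}) : bool :=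
  [forall i : 'I_l, 1 <= k i] &&
  [forall i : 'I_l, forall i' : 'I_l, (i' == i.+1 :> nat) ==> (k i < k i')].

Definition weak_chain (I : seq nat) (w n : nat)
    (j : {ffun 'I_w -> 'I_n.+1}) : bool :=
  [forall i : 'I_w, 1 <= j i] &&
  [forall i : 'I_w, forall i' : 'I_w, (i' == i.+1 :> nat) ==>
     (j i <= j i') && ((i.+1 \in I) ==> (j i < j i'))].

(* For m > 0: j_m = k. Vacuously true when m = 0. *)
Definition last_is (k m n : nat) (j : {ffun 'I_m -> 'I_n.+1}) : bool :=
  [forall i : 'I_m, (i.+1 == m) ==> (j i == k :> nat)].

End Index.

Definition kterm (F : fieldType) (q : F) (l n : nat) (s : 'I_l -> nat)
    (k : {ffun 'I_l -> 'I_n.+1}) : F :=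
  \prod_(i < l) (q ^+ ((s i - 1) * k i)%N / qint q (k i) ^+ s i).

Definition jterm (F : fieldType) (q : F) (w n : nat)
    (j : {ffun 'I_w -> 'I_n.+1}) : F :=
  \prod_(i < w) (q ^+ j i / qint q (j i)).

(* Main.v *)
(** Let [T f n] be the sum of [n choose k]_q (-1)^k q^(C(k,2)+k) f(k) over
    [k <= n], and write [x k = q^k / [k]_q]. Pascal's rule and the closed form
    of the truncated alternating q-binomial sums give
      T (x f) n = sum_(j <= n) x j * T f j,
      T (k |-> [k]_q^-1 sum_(m < k) h m) n
        = - sum_(1 <= j <= n) x j * T h (j - 1),
    so that appending a factor x(k)^(s-1) [k]_q^-1 to a strict chain corresponds
    under T to appending a block of s weakly increasing indices to a weak chain.
    For the transform U with q^(C(k,2)-nk) the increments satisfy, dually,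
      D (U (k |-> x k * sum_(j <= k) f j)) n = x n * D (U f) n,
      D (U (k |-> x k * sum_(j < k) f j)) n = - [n]_q^-1 * U f (n - 1). *)

Require Import Defs.
From HB Require Import structures.
From mathcomp Require Import all_boot all_order all_algebra.
From mathcomp Require Import ring zify.

Set Implicit Arguments.
Unset Strict Implicit.
Unset Printing Implicit Defensive.

Import GRing.Theory.
Local Open Scope ring_scope.

(** * Summation by parts, Gaussian binomials and the first transform *)

Lemma abel_sum (R : comNzRingType) (c h : nat -> R) N :
  \sum_(k < N) c k * (\sum_(m < k) h m) =
  (\sum_(k < N) c k) * (\sum_(m < N) h m)
  - \sum_(m < N) (\sum_(k < m.+1) c k) * h m.
Proof.
elim: N => [|N IHN]; first by rewrite !big_ord0; ring.
by rewrite !big_ord_recr /= IHN; ring.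
Qed.

Section QBinomialTransforms.
Variables (F : fieldType) (q : F).
Hypothesis q_not_root : forall k, q ^+ k.+1 != 1.

(* Unlike [qbinom], this vanishes for [k > n], because of the factor [i = n]. *)
Definition gbin (n k : nat) : F :=
  \prod_(i < k) ((1 - q ^+ (n - i)) / (1 - q ^+ i.+1)).

Lemma subr_expS_neq0 k : 1 - q ^+ k.+1 != 0.
Proof. by rewrite subr_eq0 eq_sym. Qed.

Lemma subr_q_neq0 : 1 - q != 0.
Proof. exact: (subr_expS_neq0 0). Qed.

Lemma qint0 : qint q 0 = 0.
Proof. by rewrite /qint expr0 subrr mul0r. Qed.

Lemma gbin0 n : gbin n 0 = 1.
Proof. by rewrite /gbin big_ord0. Qed.

Lemma gbinSr n k :
  gbin n k.+1 = gbin n k * ((1 - q ^+ (n - k)) / (1 - q ^+ k.+1)).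
Proof. by rewrite /gbin big_ord_recr. Qed.

(** Absorption: shifting the numerator indices by one exposes the new top factor, and the
    denominator gains its last one. *)
Lemma gbinSS n k :
  gbin n.+1 k.+1 = gbin n k * ((1 - q ^+ n.+1) / (1 - q ^+ k.+1)).
Proof.
rewrite /gbin !prodf_div big_ord_recl /= subn0 [in X in _ / X]big_ord_recr /=.
under eq_bigr => i _ do rewrite /bump /= add1n subSS.
by rewrite [1 - q ^+ n.+1]lock invfM; ring.
Qed.

Lemma gbin_small n k : (n < k)%N -> gbin n k = 0.
Proof.
move=> lt_nk; rewrite /gbin (bigD1 (Ordinal lt_nk)) //=.
by rewrite subnn expr0 subrr !mul0r.
Qed.

Lemma gbin_qbinom n k : (k <= n)%N -> qbinom q n k = gbin n k.
Proof.
elim: k n => [|k IHk] n; first by rewrite gbin0 /qbinom big_geq.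
case: n => // n le_kn; rewrite gbinSS -IHk // /qbinom big_nat_recr //=.
by rewrite subSS addnS subnK.
Qed.

Lemma gbin_pascalr n k :
  gbin n.+1 k.+1 = gbin n k.+1 + gbin n k * q ^+ (n - k).
Proof.
(* Truncation of [n - k] is harmless: for [n < k] every term contains a vanishing [gbin]. *)
have [lt_nk|le_kn] := ltnP n k.
  by rewrite gbinSS gbinSr gbin_small // !mul0r addr0.
rewrite gbinSS gbinSr.
have -> : q ^+ n.+1 = q ^+ (n - k) * q ^+ k.+1 by rewrite -exprD addnS subnK.
by field; apply: subr_expS_neq0.
Qed.

Lemma gbin_pascall n k :
  gbin n.+1 k.+1 = q ^+ k.+1 * gbin n k.+1 + gbin n k.
Proof.
have [lt_nk|le_kn] := ltnP n k.
  by rewrite gbinSS gbinSr gbin_small // !mul0r mulr0 addr0.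
rewrite gbinSS gbinSr.
have -> : q ^+ n.+1 = q ^+ (n - k) * q ^+ k.+1 by rewrite -exprD addnS subnK.
by field; apply: subr_expS_neq0.
Qed.

Lemma qint_gbinSS n k :
  gbin n.+1 k.+1 * (qint q k.+1 / qint q n.+1) = gbin n k.
Proof.
rewrite gbinSS /qint; field.
by rewrite !subr_expS_neq0 subr_q_neq0.
Qed.

Definition tcoef n k : F := gbin n k * (-1) ^+ k * q ^+ 'C(k, 2).

(** Pascal's rule makes the sum telescope. The value is [tcoef n m * q ^+ m], the coefficient of
    [qtrans] in row [n], so summation by parts leads from row [n.+1] to row [n]. *)
Lemma sum_tcoef n m :
  \sum_(k < m.+1) tcoef n.+1 k =
  (-1) ^+ m * q ^+ ('C(m, 2) + m) * gbin n m.
Proof.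
elim: m => [|m IHm].
  by rewrite big_ord1 /tcoef !gbin0 bin0n; ring.
rewrite big_ord_recr /= IHm /tcoef gbin_pascall binS bin1.
by rewrite !exprD !exprS; ring.
Qed.

Definition qtrans (f : nat -> F) n : F :=
  \sum_(k < n.+1) tcoef n k * q ^+ k * f k.

Lemma tcoef_small n k : (n < k)%N -> tcoef n k = 0.
Proof. by move=> lt_nk; rewrite /tcoef gbin_small // !mul0r. Qed.

(** By Pascal's rule the coefficients at [k.+1] differ by a multiple of [gbin n k * q ^+ (n - k)],
    whose power of [q] combines with [q ^+ k.+1] to [q ^+ n.+1]. Absorption then restores row [n.+1]
    with the factor [k]/[n+1], ready to cancel a denominator [k] in [f]. *)
Lemma qtrans_diff f n :
  qtrans f n.+1 - qtrans f n =
  q ^+ n.+1 * \sum_(k < n.+2) tcoef n.+1 k * (qint q k / qint q n.+1) * f k.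
Proof.
have -> : qtrans f n = \sum_(k < n.+2) tcoef n k * q ^+ k * f k.
  by rewrite big_ord_recr /= tcoef_small // !mul0r addr0.
rewrite -sumrB mulr_sumr; apply: eq_bigr => -[[|k] /= lt_kn] _.
  by rewrite qint0 /tcoef !gbin0; ring.
transitivity ((tcoef n.+1 k.+1 - tcoef n k.+1) * q ^+ k.+1 * f k.+1).
  by ring.
have := qint_gbinSS n k; rewrite /tcoef => e.
transitivity (q ^+ n.+1 * (-1) ^+ k.+1 * q ^+ 'C(k.+1, 2) * f k.+1 *
   (gbin n.+1 k.+1 * (qint q k.+1 / qint q n.+1))); last by ring.
rewrite e gbin_pascalr.
have -> : q ^+ n.+1 = q ^+ (n - k) * q ^+ k.+1 by rewrite -exprD addnS subnK.
by ring.
Qed.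

Lemma qint_neq0 n : qint q n.+1 != 0.
Proof. by rewrite /qint mulf_neq0 ?invr_neq0 ?subr_expS_neq0 ?subr_q_neq0. Qed.

(* The term [j = 0] on the right vanishes, as [qint q 0 = 0] and [x / 0 = 0]. *)
Lemma qtransM f n :
  f 0%N = 0 ->
  qtrans (fun k => q ^+ k / qint q k * f k) n =
  \sum_(j < n.+1) q ^+ j / qint q j * qtrans f j.
Proof.
move=> f0; elim: n => [|n IHn].
  by rewrite /qtrans !big_ord1 qint0 invr0 !(mulr0, mul0r).
rewrite big_ord_recr /= -IHn; apply/eqP; rewrite addrC -subr_eq; apply/eqP.
rewrite qtrans_diff /qtrans -mulrA; congr (_ * _).
rewrite mulr_sumr; apply: eq_bigr => -[[|k] /= _] _.
  by rewrite f0 !mulr0.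
by field; rewrite !qint_neq0.
Qed.

Lemma qtrans_strict (h : nat -> F) n :
  qtrans (fun k => (qint q k)^-1 * \sum_(m < k) h m) n =
  - \sum_(j < n) q ^+ j.+1 / qint q j.+1 * qtrans h j.
Proof.
elim: n => [|n IHn].
  by rewrite /qtrans big_ord1 qint0 !big_ord0 !(mulr0, oppr0).
rewrite big_ord_recr /= opprD -IHn.
apply/eqP; rewrite addrC -subr_eq; apply/eqP.
rewrite qtrans_diff -mulrN -mulrA; congr (_ * _).
transitivity ((qint q n.+1)^-1 *
    \sum_(k < n.+2) tcoef n.+1 k * \sum_(m < k) h m).
  rewrite mulr_sumr; apply: eq_bigr => -[[|k] /= _] _.
    by rewrite big_ord0 !mulr0.
  by field; rewrite !qint_neq0.
(* The boundary term is a full alternating row sum, which vanishes as [gbin n n.+1 = 0]; so does the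
   last term of the remaining sum. *)
congr (_ * _); rewrite abel_sum sum_tcoef gbin_small // mulr0 mul0r sub0r.
congr (- _); rewrite big_ord_recr /= sum_tcoef gbin_small // mulr0 mul0r addr0.
by apply: eq_bigr => k _; rewrite sum_tcoef /tcoef exprD; ring.
Qed.

(** * The transform with negative powers of q *)

Hypothesis q_neq0 : q != 0.

Definition utrans (f : nat -> F) n : F :=
  \sum_(k < n.+1) tcoef n k * q ^- (n * k) * f k.

(** Row [n.+1] is paired with the twist of row [n]: then the other form of Pascal's rule telescopes,
    and the partial sums are the coefficients of [utrans] in row [n]. *)
Lemma sum_tcoef_inv n m :
  \sum_(k < m.+1) tcoef n.+1 k * q ^- (n * k) = tcoef n m * q ^- (n * m).
Proof.
elim: m => [|m IHm].
  by rewrite big_ord1 /tcoef !gbin0 bin0n.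
rewrite big_ord_recr /= IHm /tcoef gbin_pascalr binS bin1 mulnS.
have [lt_nm|le_mn] := ltnP n m.
  by rewrite ![gbin n _]gbin_small ?leqW // !(mul0r, addr0).
have e : q ^+ n = q ^+ (n - m) * q ^+ m by rewrite -exprD subnK.
rewrite !exprD !exprS e; field.
by rewrite !expf_neq0.
Qed.

Lemma utrans_diff f n :
  utrans f n.+1 - utrans f n =
  \sum_(k < n.+2) tcoef n.+1 k * q ^- (n.+1 * k) * (qint q k / qint q n.+1)
     * f k.
Proof.
have -> : utrans f n = \sum_(k < n.+2) tcoef n k * q ^- (n * k) * f k.
  by rewrite big_ord_recr /= tcoef_small // !mul0r addr0.
rewrite -sumrB; apply: eq_bigr => -[[|k] /= lt_kn] _.
  by rewrite qint0 /tcoef !gbin0 !muln0; ring.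
have := qint_gbinSS n k; rewrite /tcoef => e.
transitivity ((-1) ^+ k.+1 * q ^+ 'C(k.+1, 2) * f k.+1 * q ^- (n.+1 * k.+1) *
   (gbin n.+1 k.+1 * (qint q k.+1 / qint q n.+1))); last by ring.
rewrite e gbin_pascall mulSn [q ^+ (k.+1 + _)]exprD.
by field; rewrite !expf_neq0.
Qed.

(** The weight q^k/[k] cancels the factor [k] of [utrans_diff] and lowers the twist from [n.+1] to
    [n], giving the coefficients that [sum_tcoef_inv] sums. At [k = 0] nothing cancels, whence
    [f 0 = 0]. *)
Lemma utrans_diff_sum (g f : nat -> F) n :
  (forall k, g k = q ^+ k / qint q k * f k) -> f 0%N = 0 ->
  utrans g n.+1 - utrans g n =
  (qint q n.+1)^-1 * \sum_(k < n.+2) tcoef n.+1 k * q ^- (n * k) * f k.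
Proof.
move=> gE f0; rewrite utrans_diff mulr_sumr.
apply: eq_bigr => -[[|k] /= _] _; first by rewrite gE f0 !mulr0.
by rewrite gE mulSn exprD; field; rewrite !expf_neq0 // !qint_neq0.
Qed.

Lemma utrans_weak (f : nat -> F) n : f 0%N = 0 ->
  let g k := q ^+ k / qint q k * \sum_(m < k.+1) f m in
  utrans g n.+1 - utrans g n =
  q ^+ n.+1 / qint q n.+1 * (utrans f n.+1 - utrans f n).
Proof.
move=> f0 g; rewrite (@utrans_diff_sum g (fun k => \sum_(m < k.+1) f m)) //;
  last by rewrite big_ord1.
rewrite [q ^+ _ / _]mulrC -mulrA; congr (_ * _).
under eq_bigr => k _ do rewrite big_ord_recr mulrDr /=.
rewrite big_split /= (abel_sum (fun k => tcoef n.+1 k * q ^- (n * k))).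
rewrite sum_tcoef_inv tcoef_small // !mul0r sub0r.
rewrite big_ord_recr /= sum_tcoef_inv tcoef_small // !mul0r addr0.
rewrite (eq_bigr (fun k : 'I_n.+1 => tcoef n k * q ^- (n * k) * f k));
  last by move=> k _; rewrite sum_tcoef_inv.
rewrite addrC -/(utrans f n) /utrans mulrBr.
(* Padding the row [n] sums with their zero term [k = n.+1] allows a termwise comparison. *)
have extend (c : F) : c * \sum_(k < n.+1) tcoef n k * q ^- (n * k) * f k =
    \sum_(k < n.+2) c * (tcoef n k * q ^- (n * k) * f k).
  by rewrite [RHS]big_ord_recr /= tcoef_small // !mul0r mulr0 addr0 mulr_sumr.
rewrite -[X in _ - X = _]mul1r !extend mulr_sumr -!sumrB.
apply: eq_bigr => -[[|k] /= lt_kn] _; first by rewrite f0 !mulr0 !subr0.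
have e : q ^+ n = q ^+ (n - k) * q ^+ k by rewrite -exprD subnK.
(* The entry of row [n.+1] occurs with both twists; each is expanded by the Pascal rule that
   isolates the row [n] entry with twist [n]. The leftover multiples of [gbin n k] agree. *)
have e2 : q ^+ n.+1 * (tcoef n.+1 k.+1 * q ^- (n.+1 * k.+1)) =
    q ^+ n.+1 * (tcoef n k.+1 * q ^- (n * k.+1)) +
    q ^+ n.+1 * (gbin n k * (-1) ^+ k.+1 * q ^+ 'C(k.+1, 2)
      * q ^- (n.+1 * k.+1)).
  rewrite /tcoef gbin_pascall mulSn exprD.
  by field; rewrite !expf_neq0.
have e3 : tcoef n.+1 k.+1 =
    tcoef n k.+1 + gbin n k * q ^+ (n - k) * (-1) ^+ k.+1 * q ^+ 'C(k.+1, 2).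
  by rewrite /tcoef gbin_pascalr; ring.
rewrite [X in _ = X - _]mulrA e2 e3 mulSn [q ^+ (k.+1 + _)]exprD !exprS e.
by field; rewrite q_neq0 !expf_neq0.
Qed.

Lemma utrans_strict (f : nat -> F) n :
  let g k := q ^+ k / qint q k * \sum_(m < k) f m in
  utrans g n.+1 - utrans g n = - ((qint q n.+1)^-1 * utrans f n).
Proof.
move=> g; rewrite (@utrans_diff_sum g (fun k => \sum_(m < k) f m)) //;
  last by rewrite big_ord0.
rewrite -mulrN; congr (_ * _).
rewrite (abel_sum (fun k => tcoef n.+1 k * q ^- (n * k))).
rewrite sum_tcoef_inv tcoef_small // !mul0r sub0r.
rewrite big_ord_recr /= sum_tcoef_inv tcoef_small // !mul0r addr0.
by congr (- _); apply: eq_bigr => k _; rewrite sum_tcoef_inv.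
Qed.

End QBinomialTransforms.

(** * Sums over chains as iterated one-variable sums *)

Section ChainSums.
Variable F : fieldType.
Implicit Types (st : pred nat) (g : nat -> nat -> F).

(* [st i] makes the inequality between the 0-based entries [i - 1] and [i]
   strict; a virtual entry 0 precedes the chain, so [st 0] encodes positivity
   of the first entry. *)
Fixpoint chain_sum st g m k : F :=
  if m is i.+1 then g i k * \sum_(a < k + ~~ st i) chain_sum st g i a
  else (k == 0)%:R.

Definition chain st m n (j : {ffun 'I_m -> 'I_n.+1}) : bool :=
  [forall i : 'I_m, 1 <= j i]%N &&
  [forall i : 'I_m, forall i' : 'I_m, (i' == i.+1 :> nat) ==>
     (j i + st i.+1 <= j i')]%N.

(* The last entry, or [0] if [m = 0]. *)
Definition last_entry m n (j : {ffun 'I_m -> 'I_n.+1}) : nat :=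
  (\sum_(i < m | i.+1 == m) j i)%N.

Definition ffun_rcons (T : finType) m (h : {ffun 'I_m -> T}) (k : T) :
    {ffun 'I_m.+1 -> T} :=
  [ffun i => if unlift ord_max i is Some i' then h i' else k].

Lemma ffun_rcons_lift (T : finType) m (h : {ffun 'I_m -> T}) k i :
  ffun_rcons h k (lift ord_max i) = h i.
Proof. by rewrite ffunE liftK. Qed.

Lemma ffun_rcons_max (T : finType) m (h : {ffun 'I_m -> T}) k :
  ffun_rcons h k ord_max = k.
Proof. by rewrite ffunE unlift_none. Qed.

Lemma sum_ffun_rcons (T : finType) m (P : pred {ffun 'I_m.+1 -> T})
    (G : {ffun 'I_m.+1 -> T} -> F) :
  \sum_(f | P f) G f =
  \sum_k \sum_(h : {ffun 'I_m -> T} | P (ffun_rcons h k)) G (ffun_rcons h k).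
Proof.
rewrite pair_big_dep /=.
rewrite (reindex (fun p : T * {ffun 'I_m -> T} => ffun_rcons p.2 p.1)) //=.
exists (fun f => (f ord_max, [ffun i => f (lift ord_max i)])).
  move=> [k h] _ /=; rewrite ffun_rcons_max; congr (_, _).
  by apply/ffunP => i; rewrite ffunE ffun_rcons_lift.
move=> f _ /=; apply/ffunP => i.
by case: (unliftP ord_max i) => [j|] ->;
  rewrite ?ffun_rcons_lift ?ffun_rcons_max ?ffunE.
Qed.

Lemma last_entryE m n (j : {ffun 'I_m -> 'I_n.+1}) (i : 'I_m) :
  i.+1 = m -> last_entry j = j i.
Proof.
move=> im; rewrite /last_entry (big_pred1 i) // => i' /=.
by rewrite -(inj_eq val_inj) /= -[RHS]eqSS im.
Qed.

Lemma last_entry_rcons m n (h : {ffun 'I_m -> 'I_n.+1}) k :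
  last_entry (ffun_rcons h k) = k.
Proof. by rewrite (@last_entryE _ _ _ ord_max) // ffun_rcons_max. Qed.

(** Only the link to the previous last entry is new. For [m = 0] that entry reads as 0, and [st 0]
    turns the link into positivity of [k]. *)
Lemma chain_rcons st m n (h : {ffun 'I_m -> 'I_n.+1}) k : st 0 ->
  chain st (ffun_rcons h k) = chain st h && (last_entry h + st m <= k)%N.
Proof.
move=> st0; apply/idP/idP.
  case/andP=> /forallP pos /forallP rel; apply/andP; split.
    apply/andP; split; apply/forallP => i.
      by have := pos (lift ord_max i); rewrite ffun_rcons_lift.
    apply/forallP => i'; have /forallP/(_ (lift ord_max i')) :=
      rel (lift ord_max i).
    by rewrite !ffun_rcons_lift !lift_max.
  case: m => [|m] in h pos rel *.
    rewrite /last_entry big_ord0 st0.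
    by have := pos ord_max; rewrite ffun_rcons_max.
  rewrite (@last_entryE _ _ _ ord_max) //.
  have /forallP/(_ ord_max)/implyP := rel (lift ord_max ord_max).
  by rewrite ffun_rcons_lift ffun_rcons_max lift_max; apply.
case/andP => /andP[/forallP pos /forallP rel] le_k.
apply/andP; split; apply/forallP => i.
  case: (unliftP ord_max i) => [j|] ->; first by rewrite ffun_rcons_lift.
  rewrite ffun_rcons_max; apply: leq_trans le_k.
  case: m => [|m] in h pos {rel i} *; first by rewrite st0 addn1.
  by rewrite (@last_entryE _ _ _ ord_max) // ltn_addr.
apply/forallP => i'; apply/implyP.
case: (unliftP ord_max i) => [j|] ->; last first.
  by move=> /eqP e; have := ltn_ord i'; rewrite e ltnn.
rewrite lift_max.
case: (unliftP ord_max i') => [j'|] -> e.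
  rewrite !ffun_rcons_lift; have := lift_max j' => /= ej.
  move: e; rewrite /= ej.
  by apply/implyP; have /forallP := rel j.
rewrite ffun_rcons_lift ffun_rcons_max.
move/eqP: e => /= e; rewrite -e.
by rewrite -(last_entryE h (esym e)).
Qed.

(* Summing against an arbitrary function of the last entry makes the induction
   on the length go through. *)
Lemma sum_chain st g m n (phi : nat -> F) : st 0 ->
  \sum_(j : {ffun 'I_m -> 'I_n.+1} | chain st j)
     phi (last_entry j) * \prod_(i < m) g i (j i) =
  \sum_(k < n.+1) phi k * chain_sum st g m k.
Proof.
move=> st0; elim: m phi => [|m IHm] phi.
  rewrite (big_pred1 [ffun=> ord0]) => [|j].
    rewrite /last_entry !big_ord0 big_ord_recl big1 ?addr0 // => i _.
    by rewrite /= mulr0.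
  rewrite /chain /=; apply/idP/eqP => _; first by apply/ffunP => -[].
  by apply/andP; split; apply/forallP => -[].
rewrite sum_ffun_rcons; apply: eq_bigr => k _ /=.
(* The link to [k] becomes an indicator of the last entry of [h], which serves as the test function
   for the induction hypothesis. *)
transitivity (phi k * g m k * \sum_(h : {ffun 'I_m -> 'I_n.+1} | chain st h)
   (last_entry h + st m <= k)%:R * \prod_(i < m) g i (h i)).
  rewrite mulr_sumr [RHS](bigID (fun h => last_entry h + st m <= k)%N) /=.
  rewrite [X in _ = _ + X]big1 ?addr0; last first.
    by move=> h /andP[_ /negbTE ->]; rewrite mul0r mulr0.
  apply: eq_big => [h|h /[!chain_rcons] // /andP[_ ->]].
    by rewrite chain_rcons.
  rewrite last_entry_rcons big_ord_recr /= ffun_rcons_max mul1r.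
  rewrite -mulrA [g m k * _]mulrC; congr (_ * (_ * _)); apply: eq_bigr => i _.
  rewrite (_ : widen_ord _ i = lift ord_max i) ?ffun_rcons_lift //.
  by apply/val_inj/esym/lift_max.
rewrite (IHm (fun a => (a + st m <= k)%:R)) -mulrA; congr (_ * (_ * _)).
rewrite (big_ord_widen_cond n.+1 xpredT (chain_sum st g m)); last first.
  by have := ltn_ord k; case: (st m) => /=; lia.
rewrite [RHS]big_mkcond /=; apply: eq_bigr => a _.
have -> : (a + st m <= k)%N = (a < k + ~~ st m)%N by case: (st m) => /=; lia.
by case: ifP; rewrite ?mul1r ?mul0r.
Qed.

Lemma sum_chain_all st g m n : st 0 ->
  \sum_(j : {ffun 'I_m -> 'I_n.+1} | chain st j) \prod_(i < m) g i (j i) =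
  \sum_(k < n.+1) chain_sum st g m k.
Proof.
move=> st0; have := @sum_chain st g m n (fun=> 1) st0.
by under eq_bigr do rewrite mul1r; under [RHS]eq_bigr do rewrite mul1r.
Qed.

Lemma last_isE k m n (j : {ffun 'I_m -> 'I_n.+1}) :
  (0 < m)%N -> last_is k j = (last_entry j == k).
Proof.
case: m j => // m j _; rewrite (@last_entryE _ _ _ ord_max) //.
apply/forallP/idP => [/(_ ord_max)/implyP -> //|jk i].
by apply/implyP => /eqP[im]; rewrite (_ : i = ord_max) //; apply: val_inj.
Qed.

(** The test function is the indicator of [k]. For [m = 0], [last_is] holds vacuously while
    [last_entry] is 0, hence [0 < m]. *)
Lemma sum_chain_last st g m n k : st 0 -> (0 < m)%N -> (k <= n)%N ->
  \sum_(j : {ffun 'I_m -> 'I_n.+1} | chain st j && last_is k j)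
     \prod_(i < m) g i (j i) =
  chain_sum st g m k.
Proof.
move=> st0 m_gt0 le_kn.
have := @sum_chain st g m n (fun a => (a == k)%:R) st0.
rewrite (bigD1 (Ordinal (le_kn : (k < n.+1)%N))) //= eqxx mul1r.
rewrite [X in _ = _ + X]big1 ?addr0; last first.
  by move=> i; rewrite -val_eqE /= => /negbTE ->; rewrite mul0r.
move <-; rewrite [RHS](bigID (fun j => last_is k j)) /=.
rewrite [X in _ = _ + X]big1 ?addr0; last first.
  by move=> j /andP[_]; rewrite last_isE // => /negbTE ->; rewrite mul0r.
by apply: eq_bigr => j /andP[_]; rewrite last_isE // => ->; rewrite mul1r.
Qed.

End ChainSums.

(** * Duality of strict and weak chains, block by block *)

Section Duality.
Variables (F : fieldType) (q : F).
Variables (l : nat) (sigma : nat -> nat) (st : pred nat).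
Hypothesis q_not_root : forall k, q ^+ k.+1 != 1.

Local Notation W a := (\sum_(i < a) sigma i)%N.
Hypothesis sigma_gt0 : forall i, (0 < sigma i)%N.
Hypothesis st_block : forall a, (a < l)%N -> st (W a).
Hypothesis weak_block : forall a t,
  (a < l)%N -> (0 < t < sigma a)%N -> ~~ st (W a + t).

Definition kweight i k : F := q ^+ ((sigma i - 1) * k)%N / qint q k ^+ sigma i.
Definition jweight k : F := q ^+ k / qint q k.
Local Notation K := (chain_sum xpredT kweight).
Local Notation J := (chain_sum st (fun=> jweight)).

Lemma jweight0 : jweight 0 = 0.
Proof. by rewrite /jweight qint0 invr0 mulr0. Qed.

(** This splits a block into one strict step, carrying 1/[k], and [(sigma i).-1] multiplications by
    [jweight]. *)
Lemma kweightE i k :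
  kweight i k = jweight k ^+ (sigma i).-1 * (qint q k)^-1.
Proof.
have := sigma_gt0 i; rewrite /kweight; case: (sigma i) => // t _.
rewrite /jweight subn1 /= mulnC exprM exprS invfM [in RHS]exprMn exprVn.
by ring.
Qed.

Lemma KS a k :
  K a.+1 k = jweight k ^+ (sigma a).-1 * ((qint q k)^-1 * \sum_(m < k) K a m).
Proof. by rewrite /= addn0 kweightE mulrA. Qed.

Lemma K0 a : K a.+1 0 = 0.
Proof. by rewrite KS big_ord0 !mulr0. Qed.

Lemma J0 m : J m.+1 0 = 0.
Proof. by rewrite /= jweight0 mul0r. Qed.

Lemma JS_strict m k : st m -> J m.+1 k = jweight k * \sum_(a < k) J m a.
Proof. by rewrite /= => ->; rewrite addn0. Qed.

Lemma JS_weak m k : ~~ st m -> J m.+1 k = jweight k * \sum_(a < k.+1) J m a.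
Proof. by rewrite /= => ->; rewrite addn1. Qed.

Lemma eq_qtrans f g n : f =1 g -> qtrans q f n = qtrans q g n.
Proof. by move=> fg; apply: eq_bigr => k _; rewrite fg. Qed.

Lemma qtrans_strict_chains a n : (a <= l)%N ->
  qtrans q (K a) n = (-1) ^+ a * \sum_(k < n.+1) J (W a) k.
Proof.
elim: a n => [|a IHa] n le_al.
  rewrite big_ord0 /qtrans big_ord_recl /tcoef gbin0 bin0n.
  rewrite [X in _ + X]big1 => [|i _]; last by rewrite /= mulr0.
  rewrite [in RHS]big_ord_recl /= [X in _ = _ * (_ + X)]big1 //.
  by ring.
(* Block [a] is built one factor at a time: [t] factors [jweight] correspond to [t.+1] indices of
   the weak chain. The start [t = 0] opens the block strictly and yields the sign. *)
suff block t n' : (t < sigma a)%N ->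
    qtrans q (fun k => jweight k ^+ t *
      ((qint q k)^-1 * \sum_(m < k) K a m)) n' =
    (-1) ^+ a.+1 * \sum_(k < n'.+1) J (W a + t).+1 k.
  rewrite (eq_qtrans _ (KS a)) block ?prednK // -addnS prednK //.
  by rewrite [(\sum_(i < a.+1) _)%N]big_ord_recr.
elim: t n' => [|t IHt] n' lt_t.
  under [LHS]eq_qtrans => k do rewrite mul1r.
  rewrite addn0 qtrans_strict // big_ord_recl J0 add0r exprS mulN1r mulNr.
  congr (- _); rewrite mulr_sumr; apply: eq_bigr => j _.
  by rewrite IHa 1?ltnW // JS_strict ?st_block // mulrCA.
under [LHS]eq_qtrans => k do rewrite exprS -mulrA.
rewrite qtransM //; last by rewrite big_ord0 !mulr0.
rewrite mulr_sumr; apply: eq_bigr => j _.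
by rewrite (IHt _ (ltnW lt_t)) addnS JS_weak 1?mulrCA // -addnS weak_block.
Qed.

Hypothesis q_neq0 : q != 0.

Lemma eq_utrans f g n : f =1 g -> utrans q f n = utrans q g n.
Proof. by move=> fg; apply: eq_bigr => k _; rewrite fg. Qed.

Lemma utrans_weak_chains a n : (a <= l)%N ->
  utrans q (J (W a)) n = (-1) ^+ a * \sum_(k < n.+1) K a k.
Proof.
elim: a n => [|a IHa] n le_al.
  rewrite big_ord0 /utrans big_ord_recl /tcoef gbin0 bin0n.
  rewrite [X in _ + X]big1 => [|i _]; last by rewrite /= mulr0.
  rewrite [in RHS]big_ord_recl /= [X in _ = _ * (_ + X)]big1 //.
  by rewrite muln0 expr0 invr1; ring.
(* Within a block it is the increments in [n] that multiply: each weak index contributes a factor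
   [jweight n'.+1]. Values are recovered by telescoping from [n = 0], where both sides vanish. *)
suff block t n' : (t < sigma a)%N ->
    utrans q (J (W a + t).+1) n'.+1 - utrans q (J (W a + t).+1) n' =
    (-1) ^+ a.+1 * (jweight n'.+1 ^+ t *
      ((qint q n'.+1)^-1 * \sum_(m < n'.+1) K a m)).
  have WS : W a.+1 = (W a + (sigma a).-1).+1.
    by rewrite -addnS prednK // big_ord_recr.
  rewrite WS; elim: n => [|n IHn].
    by rewrite big_ord1 K0 mulr0 /utrans big_ord1 J0 mulr0.
  rewrite [in RHS]big_ord_recr mulrDr -IHn KS -block ?prednK //.
  by rewrite addrC subrK.
elim: t n' => [|t IHt] n' lt_t.
  rewrite !(eq_utrans _ (fun k => JS_strict k _)) ?addn0 ?st_block //.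
  rewrite utrans_strict // IHa 1?ltnW //.
  by rewrite exprS expr0 mul1r mulN1r mulNr mulrCA.
rewrite addnS !(eq_utrans _ (fun k => JS_weak k _)) -?addnS ?weak_block //.
rewrite utrans_weak ?addnS ?J0 // IHt 1?ltnW //.
by rewrite mulrCA [jweight _ ^+ _.+1]exprS /jweight !mulrA.
Qed.

End Duality.

(** * Translation from the families of the statement *)

Lemma strict_chainE l n (k : {ffun 'I_l -> 'I_n.+1}) :
  strict_chain k = chain xpredT k.
Proof.
congr (_ && _); apply: eq_forallb => i; apply: eq_forallb => i'.
by rewrite addn1.
Qed.

(** The extra 0 secures [st 0]; links test only positions [i.+1], so it does not alter the chain
    condition. *)
Lemma weak_chainE I w n (j : {ffun 'I_w -> 'I_n.+1}) :
  weak_chain I j = chain (mem (0%N :: I)) j.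
Proof.
congr (_ && _); apply: eq_forallb => i; apply: eq_forallb => i'.
congr (_ ==> _); rewrite -[mem _ _]/(i.+1 \in 0%N :: I) inE.
by case: (_ \in I); rewrite /= ?addn1 ?addn0 ?andbT // andb_idl // => /ltnW.
Qed.

Lemma qvar_expS_neq1 k : qvar ^+ k.+1 != 1.
Proof.
rewrite /qvar -tofracXn -tofrac1 tofrac_eq.
apply/eqP => /(congr1 (fun p : {poly rat} => size p)).
by rewrite size_polyXn size_poly1.
Qed.

Lemma qvar_neq0 : qvar != 0.
Proof. by rewrite /qvar tofrac_eq0 polyX_eq0. Qed.

Section SizeFunction.
Variables (l : nat) (s : 'I_l -> nat).
Hypothesis l_gt0 : (0 < l)%N.

(** The default 1 keeps all block sizes positive, also past [l]. *)
Definition size_ext (i : nat) : nat := oapp s 1%N (insub i).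

Lemma size_extE (i : 'I_l) : size_ext i = s i.
Proof. by rewrite /size_ext valK. Qed.

Lemma size_ext_gt0 : (forall i, 0 < s i)%N -> forall i, (0 < size_ext i)%N.
Proof. by move=> s_gt0 i; rewrite /size_ext; case: insub => /=. Qed.

Lemma weightE : weight s = (\sum_(i < l) size_ext i)%N.
Proof. by apply: eq_bigr => i _; rewrite size_extE. Qed.

Lemma jumpsE :
  0%N :: jumps s = [seq (\sum_(i < m) size_ext i)%N | m <- iota 0 l].
Proof.
rewrite -[X in iota 0 X](prednK l_gt0) /= big_ord0; congr (_ :: _).
apply/eq_in_map => m; rewrite mem_iota add1n prednK // => /andP[_ lt_ml].
rewrite (big_ord_widen l size_ext (ltnW lt_ml)).
by apply: eq_bigr => i _; rewrite size_extE.
Qed.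

Lemma jumps_block a :
  (a < l)%N -> (\sum_(i < a) size_ext i)%N \in 0%N :: jumps s.
Proof. by move=> lt_al; rewrite jumpsE map_f // mem_iota. Qed.

Lemma jumps_weak_block a t : (0 < t < size_ext a)%N ->
  (\sum_(i < a) size_ext i + t)%N \notin 0%N :: jumps s.
Proof.
case/andP=> t_gt0 lt_t; rewrite jumpsE; apply/mapP => -[m _].
have mono : {homo (fun m => \sum_(i < m) size_ext i)%N : x y / (x <= y)%N}.
  move=> x y le_xy; rewrite (big_ord_widen y size_ext le_xy).
  by rewrite [leqRHS](bigID (fun i : 'I_y => i < x)%N) leq_addr.
(* Partial sums are monotone, so none lies strictly between those of index [a] and [a.+1]. *)
have [/mono | /mono] := leqP m a; first by lia.
by rewrite big_ord_recr /=; lia.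
Qed.

End SizeFunction.

Theorem theorem8p1 (l n : nat) (s : 'I_l -> nat) (hl : (1 <= l)%N)
    (hn : (1 <= n)%N) (hs : forall i : 'I_l, (1 <= s i)%N) :
  \sum_(1 <= k < n.+1)
     qbinom qvar n k * (-1) ^+ k * qvar ^+ ('C(k, 2) + k)%N *
     (\sum_(kk : {ffun 'I_l -> 'I_n.+1} | strict_chain kk && last_is k kk)
        kterm qvar s kk)
  = (-1) ^+ l *
    \sum_(j : {ffun 'I_(weight s) -> 'I_n.+1} | weak_chain (jumps s) j)
       jterm qvar j
  /\
  \sum_(1 <= k < n.+1)
     qbinom qvar n k * (-1) ^+ k * qvar ^ (('C(k, 2))%:Z - (n * k)%:Z) *
     (\sum_(j : {ffun 'I_(weight s) -> 'I_n.+1} |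
              weak_chain (jumps s) j && last_is k j)
        jterm qvar j)
  = (-1) ^+ l *
    \sum_(kk : {ffun 'I_l -> 'I_n.+1} | strict_chain kk) kterm qvar s kk.
Proof.
pose st : pred nat := mem (0%N :: jumps s).
pose sigma := size_ext s.
pose K := chain_sum xpredT (kweight qvar sigma).
pose J := chain_sum st (fun=> jweight qvar).
have sigma_gt0 := size_ext_gt0 hs.
have st_block a (lt_al : (a < l)%N) := jumps_block s hl lt_al.
have weak_block a t (_ : (a < l)%N) := @jumps_weak_block _ s hl a t.
have weight_gt0 : (0 < weight s)%N.
  by rewrite weightE (bigD1 (Ordinal hl)) //= addn_gt0 sigma_gt0.
have ktermE (kk : {ffun 'I_l -> 'I_n.+1}) :
    kterm qvar s kk = \prod_(i < l) kweight qvar sigma i (kk i).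
  by apply: eq_bigr => i _; rewrite /kweight /sigma size_extE.
have K_last k : (k <= n)%N ->
    \sum_(kk : {ffun 'I_l -> 'I_n.+1} | strict_chain kk && last_is k kk)
       kterm qvar s kk = K l k.
  move=> le_kn; rewrite /K -(sum_chain_last _ _ hl le_kn) //.
  by apply: eq_big => kk *; rewrite ?strict_chainE.
have K_all : \sum_(kk : {ffun 'I_l -> 'I_n.+1} | strict_chain kk)
    kterm qvar s kk = \sum_(k < n.+1) K l k.
  rewrite /K -sum_chain_all //.
  by apply: eq_big => kk *; rewrite ?strict_chainE.
have J_last k : (k <= n)%N ->
    \sum_(j : {ffun 'I_(weight s) -> 'I_n.+1} |
        weak_chain (jumps s) j && last_is k j) jterm qvar j = J (weight s) k.
  move=> le_kn; rewrite /J -(sum_chain_last _ _ weight_gt0 le_kn) //.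
  by apply: eq_bigl => j; rewrite weak_chainE.
have J_all : \sum_(j : {ffun 'I_(weight s) -> 'I_n.+1} |
    weak_chain (jumps s) j) jterm qvar j = \sum_(k < n.+1) J (weight s) k.
  rewrite /J -sum_chain_all //.
  by apply: eq_bigl => j; rewrite weak_chainE.
have K_0 m : (0 < m)%N -> K m 0 = 0 by case: m => // m _; exact: K0.
have J_0 m : (0 < m)%N -> J m 0 = 0 by case: m => // m _; exact: J0.
have q1 := qvar_expS_neq1; have q0 := qvar_neq0.
(* The transforms start at [k = 0], where the inner sum is zero because the chains are nonempty; for
   [k <= n] the two binomials agree. *)
split; rewrite big_add1 big_mkord.
  rewrite J_all weightE.
  rewrite -(qtrans_strict_chains q1 sigma_gt0 st_block weak_block) //.
  rewrite /qtrans big_ord_recl /= -/K K_0 // mulr0 add0r.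
  apply: eq_bigr => k _; rewrite K_last // gbin_qbinom // exprD.
  by rewrite /tcoef !mulrA.
rewrite K_all.
rewrite -(utrans_weak_chains q1 sigma_gt0 st_block weak_block) // -weightE.
rewrite /utrans big_ord_recl /= -/J J_0 // mulr0 add0r.
apply: eq_bigr => k _; rewrite J_last // gbin_qbinom // expfzDr //.
by rewrite /tcoef -exprnN -exprnP !mulrA.
Qed.
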